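(* Let $k$ be a field, let $(\mathcal D,F)$ be a $\mathbb Z$-equivariant $k$-linear category (so $F$ is an automorphism of $\mathcal D$) such that $\mathcal D$ has a Serre structure $(\mathbb S,\kappa)$, and let $\mathbb T=\mathbb S^-F$. Let $\chi:\mathbb Z\to k^\times$ be a character, let $0\le N\le m$ be integers and let $r=m-N$. The following are equivalent: (a) $(\mathcal D,F)$ is $\chi$-synthetic Calabi-Yau of dimension $N/m$, i.e. with $s=\chi(1)\zeta_F$ we have $(\mathbb S,s)^m\cong(F,\chi(1)\,\mathrm{id}_{F^2})^N$ as $F$-equivariant endofunctors; (b) the $\mathbb Z$-equivariant category $(\mathcal D,\mathbb T)$ has a $\chi$-equivariant Serre functor $(\mathbb S,s')$ (so $s'=\chi(1)\zeta_{\mathbb T}$) and $(\mathbb S,s')^{r}\cong(\mathbb T,\mathrm{id}_{\mathbb T^2})^N$ as $\mathbb T$-equivariant endofunctors; (c) the $\mathbb Z$-equivariant category $(\mathcal D,F)$ has a $\chi$-equivariant Serre functor $(\mathbb S,s)$ and $(\mathbb T,\zeta^\dagger_FF)^m\cong(F,\chi(1)\,\mathrm{id}_{F^2})^{r}$ as $F$-equivariant endofunctors.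
   Context: All categories and functors are $k$-linear; $V^*=\mathrm{Hom}_k(V,k)$. Serre structure: a pair $(\mathbb S,\kappa)$ with $\mathbb S:\mathcal D\to\mathcal D$ an autoequivalence and $\kappa_{x,y}:\mathcal D(x,y)\to\mathcal D(y,\mathbb Sx)^*$ linear isomorphisms (hom spaces finite-dimensional) with $\kappa(hg)(u)=\kappa(g)(uh)$ and $\kappa(gf)(u)=\kappa(g)(\mathbb S(f)u)$ for composable $f,g,h$ and $u$ of the appropriate type. $\mathbb S^-$ is a fixed quasi-inverse of $\mathbb S$ with unit $\eta:\mathrm{id}\to\mathbb S\mathbb S^-$ and counit $\varepsilon:\mathbb S^-\mathbb S\to\mathrm{id}$ of an adjoint equivalence. For an autoequivalence $E$ with quasi-inverse $E^-$ (in an adjoint equivalence), $\zeta_E:\mathbb SE\to E\mathbb S$ is the canonical natural isomorphism characterised by $\kappa_{Ey,x}(e)(u)=\kappa_{y,E^-x}(e^\flat)\big((\zeta_{E,y}u)^\sharp\big)$ for $e\in\mathcal D(Ey,x)$, $u\in\mathcal D(x,\mathbb SEy)$, where $e^\flat:y\to E^-x$ and $(\zeta_{E,y}u)^\sharp:E^-x\to\mathbb Sy$ are the adjuncts of $e$ and $\zeta_{E,y}u$. Also $\zeta^\dagger_E:\mathbb S^-E\to E\mathbb S^-$ is the composite $\mathbb S^-E\xrightarrow{\mathbb S^-E\eta}\mathbb S^-E\mathbb S\mathbb S^-\xrightarrow{\mathbb S^-\zeta_E^{-1}\mathbb S^-}\mathbb S^-\mathbb SE\mathbb S^-\xrightarrow{\varepsilon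 E\mathbb S^-}E\mathbb S^-$; thus $\zeta_F^\dagger F:\mathbb TF=\mathbb S^-FF\to F\mathbb S^-F=F\mathbb T$. Equivariant functors: for an autoequivalence $E$ of $\mathcal D$, an $E$-equivariant endofunctor is a pair $(\Phi,\phi)$ with $\phi:\Phi E\to E\Phi$ a natural isomorphism; composition is $(\Psi,\psi)(\Phi,\phi)=(\Psi\Phi,\psi\Phi\circ\Psi\phi)$ and powers are taken with respect to it; $(\Phi,\phi)\cong(\Psi,\psi)$ means there is a natural isomorphism $\alpha:\Phi\to\Psi$ with $\psi\circ\alpha E=E\alpha\circ\phi$. (If $\mathbb T$ is only an autoequivalence, $(\mathcal D,\mathbb T)$ is regarded as a $\mathbb Z$-equivariant category via strictification; the notions just given do not require strictness.) A $\chi$-equivariant Serre functor for $(\mathcal D,E)$ is a pair $(\mathbb S,s)$ with $(\mathbb S,\kappa)$ a Serre structure on $\mathcal D$ and $s=\chi(1)\zeta_E:\mathbb SE\to E\mathbb S$. *)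

(* Defs.v *)
From HB Require Import structures.
From mathcomp Require Import all_boot all_order all_algebra.
From mathcomp Require Import boolp.

Set Implicit Arguments.
Unset Strict Implicit.
Unset Printing Implicit Defensive.

Import GRing.Theory.
Local Open Scope ring_scope.

Declare Scope kcat_scope.
Delimit Scope kcat_scope with kcat.
Local Open Scope kcat_scope.

Record kcategory (k : fieldType) := KCategory {
  obj :> Type;
  hom : obj -> obj -> lmodType k;
  idm : forall x, hom x x;
  comp : forall x y z, hom y z -> hom x y -> hom x z;
  comp_linearl : forall x y z (f : hom x y), linear ((@comp x y z)^~ f);
  comp_linearr : forall x y z (g : hom y z), linear (@comp x y z g);
  compA : forall x y z w (h : hom z w) (g : hom y z) (f : hom x y),
    comp h (comp g f) = comp (comp h g) f;
  comp1m : forall x y (f : hom x y), comp (idm y) f = f;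
  compm1 : forall x y (f : hom x y), comp f (idm x) = f }.

Arguments hom {k D} x y : rename.
Arguments idm {k D} x : rename.
Arguments comp {k D x y z} g f : rename.
Arguments comp_linearl {k D x y z} f : rename.
Arguments comp_linearr {k D x y z} g : rename.

Notation "g \c f" := (comp g f) (at level 40, left associativity) : kcat_scope.

Record endofunctor (k : fieldType) (D : kcategory k) := EndoFunctor {
  fobj :> D -> D;
  fmap : forall x y, {linear hom x y -> hom (fobj x) (fobj y)};
  fmap1 : forall x, fmap x x (idm x) = idm (fobj x);
  fmapM : forall x y z (g : hom y z) (f : hom x y),
    fmap x z (g \c f) = fmap y z g \c fmap x y f }.

Arguments fmap {k D} F {x y} : rename.

Record nat_iso (k : fieldType) (D : kcategory k) (F G : endofunctor D) :=
  NatIso {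
    niso :> forall x, hom (F x) (G x);
    niso_inv : forall x, hom (G x) (F x);
    niso_nat : forall x y (f : hom x y), niso y \c fmap F f = fmap G f \c niso x;
    nisoK : forall x, niso_inv x \c niso x = idm (F x);
    nisoVK : forall x, niso x \c niso_inv x = idm (G x) }.

Section Functors.
Context {k : fieldType} {D : kcategory k}.
Implicit Types (F G : endofunctor D).

Lemma comp0m (x y z : D) (f : hom x y) : (0 : hom y z) \c f = 0.
Proof.
have := comp_linearl f 1 (0 : hom y z) 0.
by rewrite !scale1r addr0 => h; apply: (addrI (0 \c f)); rewrite -h addr0.
Qed.

Lemma compDm (x y z : D) (f : hom x y) (g g' : hom y z) :
  (g + g') \c f = g \c f + g' \c f.
Proof. by have := comp_linearl f 1 g g'; rewrite !scale1r. Qed.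

Lemma compmD (x y z : D) (g : hom y z) (f f' : hom x y) :
  g \c (f + f') = g \c f + g \c f'.
Proof. by have := comp_linearr g 1 f f'; rewrite !scale1r. Qed.

Lemma compm0 (x y z : D) (g : hom y z) : g \c (0 : hom x y) = 0.
Proof. by apply: (addrI (g \c 0)); rewrite -compmD !addr0. Qed.

Lemma compZm (x y z : D) (f : hom x y) (a : k) (g : hom y z) :
  (a *: g) \c f = a *: (g \c f).
Proof. by have := comp_linearl f a g 0; rewrite comp0m !addr0. Qed.

Lemma compmZ (x y z : D) (g : hom y z) (a : k) (f : hom x y) :
  g \c (a *: f) = a *: (g \c f).
Proof. by have := comp_linearr g a f 0; rewrite compm0 !addr0. Qed.

Lemma niso_inv_nat F G (a : nat_iso F G) (x y : D) (f : hom x y) :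
  niso_inv a y \c fmap G f = fmap F f \c niso_inv a x.
Proof.
rewrite -[LHS]compm1 -(nisoVK a x) !compA -(compA (niso_inv a y)) -niso_nat.
by rewrite compA nisoK comp1m.
Qed.

Program Definition fid : endofunctor D :=
  @EndoFunctor k D (fun x => x) (fun x y => idfun) _ _.

Program Definition fcomp G F : endofunctor D :=
  @EndoFunctor k D (fun x => G (F x)) (fun x y => fmap G \o fmap F) _ _.
Next Obligation. by rewrite /= !fmap1. Qed.
Next Obligation. by rewrite /= !fmapM. Qed.

Definition niso_id F : nat_iso F F.
Proof.
refine (@NatIso k D F F (fun x => idm (F x)) (fun x => idm (F x)) _ _ _).
- by move=> x y f; rewrite comp1m compm1.
- by move=> x; rewrite comp1m.
- by move=> x; rewrite comp1m.
Defined.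

Definition niso_sym F G (a : nat_iso F G) : nat_iso G F :=
  @NatIso k D G F (niso_inv a) a (@niso_inv_nat F G a) (nisoVK a) (nisoK a).

Definition niso_scale (c : k) (c0 : c != 0) F G (a : nat_iso F G) :
  nat_iso F G.
Proof.
refine (@NatIso k D F G (fun x => c *: a x) (fun x => c^-1 *: niso_inv a x)
  _ _ _).
- by move=> x y f; rewrite compZm compmZ niso_nat.
- by move=> x; rewrite compZm compmZ scalerA mulVf // scale1r nisoK.
- by move=> x; rewrite compZm compmZ scalerA mulfV // scale1r nisoVK.
Defined.

End Functors.

Arguments fid {k} D.

(* Autoequivalences carry a quasi-inverse [E^-] and the unit [id -> E E^-] and
   counit [E^- E -> id] of an adjoint equivalence [E^- -| E]; the adjunction
   [E -| E^-] is the one given by the inverses of the counit and unit. *)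
Record autoequivalence (k : fieldType) (D : kcategory k) := AutoEquivalence {
  ae_fun :> endofunctor D;
  ae_inv : endofunctor D;
  ae_unit : nat_iso (fid D) (fcomp ae_fun ae_inv);
  ae_counit : nat_iso (fcomp ae_inv ae_fun) (fid D);
  ae_triangle : forall x : D,
    fmap ae_fun (ae_counit x) \c ae_unit (ae_fun x) = idm (ae_fun x);
  ae_inv_triangle : forall x : D,
    ae_counit (ae_inv x) \c fmap ae_inv (ae_unit x) = idm (ae_inv x) }.

Section Autoequivalences.
Context {k : fieldType} {D : kcategory k}.

Definition ae_sym (E : autoequivalence D) : autoequivalence D.
Proof.
refine (@AutoEquivalence k D (ae_inv E) E
  (niso_sym (ae_counit E)) (niso_sym (ae_unit E)) _ _) => x /=.
- have /(congr1 (fun h => fmap (ae_inv E) (niso_inv (ae_unit E) x) \c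
    (niso_inv (ae_counit E) (ae_inv E x) \c h))) := ae_inv_triangle E x.
  rewrite compm1 => <-.
  by rewrite (compA (niso_inv _ _)) nisoK comp1m -fmapM nisoK fmap1.
- have /(congr1 (fun h => niso_inv (ae_unit E) (E x) \c
    (fmap E (niso_inv (ae_counit E) x) \c h))) := ae_triangle E x.
  rewrite compm1 => <-.
  by rewrite (compA (fmap E _)) -fmapM nisoK fmap1 comp1m nisoK.
Defined.

Definition ae_comp_unit (A B : autoequivalence D) :
  nat_iso (fid D) (fcomp (fcomp A B) (fcomp (ae_inv B) (ae_inv A))).
Proof.
refine (@NatIso k D (fid D) (fcomp (fcomp A B) (fcomp (ae_inv B) (ae_inv A)))
  (fun x => fmap A (ae_unit B (ae_inv A x)) \c ae_unit A x)
  (fun x =>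
     niso_inv (ae_unit A) x \c fmap A (niso_inv (ae_unit B) (ae_inv A x)))
  _ _ _).
- move=> x y f /=.
  have /= eA := niso_nat (ae_unit A) f.
  have /= eB := niso_nat (ae_unit B) (fmap (ae_inv A) f).
  by rewrite -compA eA !compA -!fmapM eB.
- move=> x /=; have /= eB := nisoK (ae_unit B) (ae_inv A x).
  rewrite compA -(compA (niso_inv (ae_unit A) x)) -fmapM eB.
  by rewrite fmap1 compm1; exact: (nisoK (ae_unit A) x).
- move=> x /=; have /= eA := nisoVK (ae_unit A) x.
  have /= eB := nisoVK (ae_unit B) (ae_inv A x).
  rewrite compA -(compA _ (ae_unit A x)) eA compm1 -fmapM eB.
  exact: fmap1.
Defined.

Definition ae_comp_counit (A B : autoequivalence D) :
  nat_iso (fcomp (fcomp (ae_inv B) (ae_inv A)) (fcomp A B)) (fid D).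
Proof.
refine (@NatIso k D (fcomp (fcomp (ae_inv B) (ae_inv A)) (fcomp A B)) (fid D)
  (fun x => ae_counit B x \c fmap (ae_inv B) (ae_counit A (B x)))
  (fun x =>
     fmap (ae_inv B) (niso_inv (ae_counit A) (B x)) \c niso_inv (ae_counit B) x)
  _ _ _).
- move=> x y f /=.
  have /= eA := niso_nat (ae_counit A) (fmap B f).
  have /= eB := niso_nat (ae_counit B) f.
  by rewrite compA -eB -!compA -!fmapM eA.
- move=> x /=; have /= eA := nisoK (ae_counit A) (B x).
  have /= eB := nisoK (ae_counit B) x.
  rewrite compA -(compA _ (niso_inv (ae_counit B) x)) eB compm1 -fmapM eA.
  exact: fmap1.
- move=> x /=; have /= eA := nisoVK (ae_counit A) (B x).
  rewrite compA -(compA (ae_counit B x)) -fmapM eA fmap1 compm1.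
  exact: (nisoVK (ae_counit B) x).
Defined.

(* The composite [A B], with quasi-inverse [B^- A^-]. *)
Definition ae_comp (A B : autoequivalence D) : autoequivalence D.
Proof.
refine (@AutoEquivalence k D (fcomp A B) (fcomp (ae_inv B) (ae_inv A))
  (ae_comp_unit A B) (ae_comp_counit A B) _ _) => x /=.
- have /= e := niso_nat (ae_unit B) (ae_counit A (B x)).
  rewrite compA -fmapM (fmapM B) -compA -e compA ae_triangle comp1m.
  exact: ae_triangle.
- have /= e := niso_nat (ae_counit A) (ae_unit B (ae_inv A x)).
  rewrite -compA -fmapM (fmapM (ae_inv A)) compA e -compA ae_inv_triangle compm1.
  exact: ae_inv_triangle.
Defined.

End Autoequivalences.

(* Strict: the two equations are Leibniz equalities of functors. *)
Record automorphism (k : fieldType) (D : kcategory k) := Automorphism {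
  aut_fun : endofunctor D;
  aut_inv : endofunctor D;
  aut_funK : fcomp aut_inv aut_fun = fid D;
  aut_invK : fcomp aut_fun aut_inv = fid D }.

Section Automorphisms.
Context {k : fieldType} {D : kcategory k}.

Definition eqm (x y : D) (e : x = y) : hom x y := eq_rect x (hom x) (idm x) y e.

Lemma eqm_id (x : D) (e : x = x) : eqm e = idm x.
Proof. by rewrite (Prop_irrelevance e erefl). Qed.

Lemma eqmM (x y z : D) (e : x = y) (e' : y = z) :
  eqm e' \c eqm e = eqm (etrans e e').
Proof. by case: z / e'; rewrite comp1m. Qed.

Lemma fmap_eqm (F : endofunctor D) (x y : D) (e : x = y) :
  fmap F (eqm e) = eqm (congr1 F e).
Proof. by case: y / e; exact: fmap1. Qed.

Definition niso_eq (F G : endofunctor D) (e : F = G) : nat_iso F G.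
Proof.
refine (@NatIso k D F G (fun x => eqm (congr1 (fun H => fobj H x) e))
  (fun x => eqm (congr1 (fun H => fobj H x) (esym e))) _ _ _).
- by case: G / e => x y f /=; rewrite comp1m compm1.
- by move=> x; rewrite eqmM eqm_id.
- by move=> x; rewrite eqmM eqm_id.
Defined.

Definition aut_ae (F : automorphism D) : autoequivalence D.
Proof.
refine (@AutoEquivalence k D (aut_fun F) (aut_inv F) (niso_eq (esym (aut_invK F)))
  (niso_eq (aut_funK F)) _ _) => x /=.
- by rewrite fmap_eqm eqmM eqm_id.
- by rewrite fmap_eqm eqmM eqm_id.
Defined.

End Automorphisms.

Coercion aut_ae : automorphism >-> autoequivalence.

Section EquivariantFunctors.
Context {k : fieldType} {D : kcategory k}.

Record equivariant (E : endofunctor D) := Equivariant {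
  eqv_fun :> endofunctor D;
  eqv_iso : nat_iso (fcomp eqv_fun E) (fcomp E eqv_fun) }.

Context {E : endofunctor D}.
Implicit Types (Phi Psi : equivariant E).

Definition eqv_id_iso : nat_iso (fcomp (fid D) E) (fcomp E (fid D)).
Proof.
refine (@NatIso k D (fcomp (fid D) E) (fcomp E (fid D))
  (fun x => idm (E x)) (fun x => idm (E x)) _ _ _) => *;
  by rewrite /= ?comp1m ?compm1.
Defined.

Definition eqv_id : equivariant E := Equivariant eqv_id_iso.

Definition eqv_comp_iso Psi Phi :
  nat_iso (fcomp (fcomp Psi Phi) E) (fcomp E (fcomp Psi Phi)).
Proof.
refine (@NatIso k D (fcomp (fcomp Psi Phi) E) (fcomp E (fcomp Psi Phi))
  (fun x => eqv_iso Psi (Phi x) \c fmap Psi (eqv_iso Phi x))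
  (fun x => fmap Psi (niso_inv (eqv_iso Phi) x) \c
            niso_inv (eqv_iso Psi) (Phi x)) _ _ _).
- move=> x y f /=.
  have /= e := niso_nat (eqv_iso Phi) f.
  have /= e' := niso_nat (eqv_iso Psi) (fmap Phi f).
  by rewrite -compA -fmapM e fmapM compA e' compA.
- move=> x /=; have /= e := nisoK (eqv_iso Phi) x.
  have /= e' := nisoK (eqv_iso Psi) (Phi x).
  rewrite compA -(compA _ (niso_inv (eqv_iso Psi) (Phi x))) e' compm1 -fmapM e.
  exact: fmap1.
- move=> x /=; have /= e := nisoVK (eqv_iso Phi) x.
  rewrite compA -(compA (eqv_iso Psi (Phi x))) -fmapM e fmap1 compm1.
  exact: (nisoVK (eqv_iso Psi) (Phi x)).
Defined.

Definition eqv_comp Psi Phi : equivariant E := Equivariant (eqv_comp_iso Psi Phi).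

Definition eqv_pow Phi (n : nat) : equivariant E := iter n (eqv_comp Phi) eqv_id.

Definition eqv_isom Phi Psi : Prop :=
  exists alpha : nat_iso Phi Psi, forall x : D,
    eqv_iso Psi x \c alpha (E x) = fmap E (alpha x) \c eqv_iso Phi x.

End EquivariantFunctors.

Notation "Phi ^^ n" := (eqv_pow Phi n)
  (at level 30, right associativity) : kcat_scope.
Notation "Phi ~= Psi" := (eqv_isom Phi Psi) (at level 70) : kcat_scope.

Definition fin_dim (k : fieldType) (V : lmodType k) : Prop :=
  exists (n : nat) (f : {linear V -> 'rV[k]_n}), bijective f.

Record serre_structure (k : fieldType) (D : kcategory k) := SerreStructure {
  serre_fun :> autoequivalence D;
  serre_fin : forall x y : D, fin_dim (hom x y);
  kappa : forall x y : D, hom x y -> {scalar hom y (serre_fun x)};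
  kappa_linear : forall (x y : D) (a : k) (f g : hom x y)
      (u : hom y (serre_fun x)),
    kappa (a *: f + g) u = a * kappa f u + kappa g u;
  kappa_bij : forall x y : D, bijective (@kappa x y);
  kappa_compl : forall (x y z : D) (h : hom y z) (g : hom x y)
      (u : hom z (serre_fun x)),
    kappa (h \c g) u = kappa g (u \c h);
  kappa_compr : forall (w x y : D) (g : hom x y) (f : hom w x)
      (u : hom y (serre_fun w)),
    kappa (g \c f) u = kappa g (fmap serre_fun f \c u) }.

Arguments kappa {k D} s {x y} : rename.

Section LinearAlgebra.
Context {k : fieldType}.

Lemma scalar_rV_expand n (h : {scalar 'rV[k]_n}) u :
  h u = (u *m \col_i h (delta_mx 0 i)) 0 0.
Proof.
rewrite {1}[u]row_sum_delta linear_sum mxE.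
by apply: eq_bigr => i _; rewrite linearZ mxE.
Qed.

Lemma fin_dim_inv (V : lmodType k) : fin_dim V ->
  exists (n : nat) (f : {linear V -> 'rV[k]_n}) (g : {linear 'rV[k]_n -> V}),
    cancel f g /\ cancel g f.
Proof.
case=> n [f [g fK gK]].
have gl : linear g.
  by move=> a u v; apply: (can_inj fK); rewrite linearP !gK.
pose gL : {linear 'rV[k]_n -> V} := HB.pack g (GRing.isLinear.Build _ _ _ _ g gl).
by exists n, f, gL.
Qed.

Lemma pairing_surj (V W : lmodType k) (B : V -> {scalar W}) (l : {scalar V}) :
    fin_dim V -> fin_dim W ->
    (forall a v v' w, B (a *: v + v') w = a * B v w + B v' w) ->
    (forall v, (forall w, B v w = 0) -> v = 0) ->
  exists w, forall v, B v w = l v.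
Proof.
move=> /fin_dim_inv[n [f [f' [fK f'K]]]] /fin_dim_inv[m [g [g' [gK g'K]]]] Bl Bi.
have Bls w : scalar (fun u => B (f' u) w).
  by move=> a u v /=; rewrite linearP Bl.
pose Bu w : {scalar 'rV[k]_n} :=
  HB.pack (fun u => B (f' u) w) (GRing.isLinear.Build _ _ _ _ _ (Bls w)).
have Bws v : scalar (fun w => B v (g' w)) by move=> a x y /=; rewrite !linearP.
pose Bw v : {scalar 'rV[k]_m} :=
  HB.pack (fun w => B v (g' w)) (GRing.isLinear.Build _ _ _ _ _ (Bws v)).
have ls : scalar (fun u => l (f' u)) by move=> a x y /=; rewrite !linearP.
pose lu : {scalar 'rV[k]_n} :=
  HB.pack (fun u => l (f' u)) (GRing.isLinear.Build _ _ _ _ _ ls).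
pose M : 'M[k]_(n, m) := \matrix_(i, j) B (f' (delta_mx 0 i)) (g' (delta_mx 0 j)).
have BE u w : B (f' u) (g' w) = (u *m M *m w^T) 0 0.
  rewrite -[LHS]/(Bu (g' w) u) scalar_rV_expand -mulmxA !mxE.
  apply: eq_bigr => i _; rewrite !mxE; congr (_ * _).
  rewrite -[LHS]/(Bw (f' (delta_mx 0 i)) w) scalar_rV_expand mxE.
  by apply: eq_bigr => j _; rewrite !mxE mulrC.
have /row_freeP[M' MM'] : row_free M.
  apply: inj_row_free => u uM0; rewrite -[u]f'K.
  rewrite (Bi (f' u)) ?linear0 // => w.
  by rewrite -[w]gK BE uM0 mul0mx mxE.
exists (g' (M' *m \col_i lu (delta_mx 0 i))^T) => v.
rewrite -[v]fK BE trmxK mulmxA -(mulmxA _ M) MM' mulmx1.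
by rewrite -scalar_rV_expand.
Qed.

Lemma scalar_ext (V : lmodType k) (f g : {scalar V}) : f =1 g -> f = g.
Proof.
case: f => f [[cf] [df]]; case: g => g [[cg] [dg]] /= /funext e.
case: g / e cg dg => cg dg.
by rewrite (Prop_irrelevance cf cg) (Prop_irrelevance df dg).
Qed.

Lemma fin_dim_coord (V : lmodType k) (v : V) :
  fin_dim V -> (forall l : {scalar V}, l v = 0) -> v = 0.
Proof.
move=> /fin_dim_inv[n [f [g [fK gK]]]] l0.
apply: (can_inj fK); rewrite linear0; apply/rowP => i; rewrite [RHS]mxE.
have cs : scalar (fun v => f v 0 i) by move=> a x y /=; rewrite linearP !mxE.
pose c : {scalar V} :=
  HB.pack (fun v => f v 0 i) (GRing.isLinear.Build _ _ _ _ _ cs).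
exact: (l0 c).
Qed.

End LinearAlgebra.

Section SerreStructures.
Context {k : fieldType} {D : kcategory k}.
Implicit Types (S : serre_structure D) (E : autoequivalence D).

(* The adjuncts [e^flat] under [E -| E^-] and [v^sharp] under [E^- -| E]. *)
Definition flat E (y x : D) (e : hom (E y) x) : hom y (ae_inv E x) :=
  fmap (ae_inv E) e \c niso_inv (ae_counit E) y.

Definition sharp E (x z : D) (v : hom x (E z)) : hom (ae_inv E x) z :=
  ae_counit E z \c fmap (ae_inv E) v.

Definition is_zeta S E (z : nat_iso (fcomp S E) (fcomp E S)) : Prop :=
  forall (x y : D) (e : hom (E y) x) (u : hom x (S (E y))),
    kappa S e u = kappa S (flat e) (sharp (z y \c u)).

Definition unflat E (y x : D) (f : hom y (ae_inv E x)) : hom (E y) x :=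
  niso_inv (ae_unit E) x \c fmap E f.

Definition unsharp E (x z : D) (w : hom (ae_inv E x) z) : hom x (E z) :=
  fmap E w \c ae_unit E x.

Lemma sharpK E (x z : D) : cancel (@sharp E x z) (@unsharp E x z).
Proof.
move=> v; rewrite /sharp /unsharp fmapM -compA.
have /= <- := niso_nat (ae_unit E) v.
by rewrite compA ae_triangle comp1m.
Qed.

Lemma unsharpK E (x z : D) : cancel (@unsharp E x z) (@sharp E x z).
Proof.
move=> w; rewrite /sharp /unsharp fmapM compA.
have /= -> := niso_nat (ae_counit E) w.
by rewrite -compA ae_inv_triangle compm1.
Qed.

Lemma unflatK E (y x : D) : cancel (@unflat E y x) (@flat E y x).
Proof. exact: (@sharpK (ae_sym E)). Qed.

Lemma flatK E (y x : D) : cancel (@flat E y x) (@unflat E y x).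
Proof. exact: (@unsharpK (ae_sym E)). Qed.

Lemma sharp_comp E (w x z : D) (v : hom x (E z)) (u : hom w x) :
  sharp (v \c u) = sharp v \c fmap (ae_inv E) u.
Proof. by rewrite /sharp fmapM compA. Qed.

Lemma flat_comp E (y x w : D) (e : hom (E y) x) (u : hom x w) :
  flat (u \c e) = fmap (ae_inv E) u \c flat e.
Proof. by rewrite /flat fmapM compA. Qed.

Lemma sharp_fmap E (x z z' : D) (g : hom z z') (v : hom x (E z)) :
  sharp (fmap E g \c v) = g \c sharp v.
Proof.
have /= e := niso_nat (ae_counit E) g.
by rewrite /sharp fmapM !compA e.
Qed.

Lemma flat_fmap E (y y' x : D) (e : hom (E y') x) (f : hom y y') :
  flat (e \c fmap E f) = flat e \c f.
Proof.
have /= h := niso_inv_nat (ae_counit E) f.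
by rewrite /flat fmapM -!compA h.
Qed.

Lemma kappa_injr S (x y : D) (u u' : hom y (S x)) :
  (forall f : hom x y, kappa S f u = kappa S f u') -> u = u'.
Proof.
move=> h; apply/eqP; rewrite -subr_eq0; apply/eqP.
apply: (fin_dim_coord (serre_fin S y (S x))) => l.
have [g _ gK] := kappa_bij S x y.
by rewrite -(gK l) linearB h subrr.
Qed.

Lemma kappa0 S (x y : D) (u : hom y (S x)) : kappa S (0 : hom x y) u = 0.
Proof.
have := kappa_linear 1 (0 : hom x y) 0 u; rewrite scale1r mul1r addr0 => h.
by apply: (addrI (kappa S 0 u)); rewrite -h addr0.
Qed.

Lemma kappa_surjr S (x y : D) (l : {scalar hom x y}) :
  exists u : hom y (S x), forall f, kappa S f u = l f.
Proof.
apply: (@pairing_surj k _ _ (@kappa k D S x y)); try exact: serre_fin.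
  exact: kappa_linear.
move=> f f0; apply: (bij_inj (kappa_bij S x y)); apply: scalar_ext => u.
by rewrite f0 kappa0.
Qed.

Lemma zeta_ex S E : exists z, @is_zeta S E z.
Proof.
have kappa1 x y (e : hom x y) (u : hom y (S x)) :
    kappa S (u \c e) (idm (S x)) = kappa S e u.
  by rewrite kappa_compl comp1m.
have ex_rep (x y : D) (w : hom x (E (S y))) : exists u : hom x (S (E y)),
    forall e : hom (E y) x, kappa S e u = kappa S (flat e) (sharp w).
  have ls : scalar (fun e : hom (E y) x => kappa S (flat e) (sharp w)).
    move=> a e e'; rewrite -kappa_linear /flat linearP compDm compZm.
    by [].
  pose l : {scalar hom (E y) x} :=
    HB.pack (fun e => kappa S (flat e) (sharp w))
      (GRing.isLinear.Build _ _ _ _ _ ls).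
  by have [u hu] := kappa_surjr S l; exists u.
have ex_z (y : D) : exists v : hom (ae_inv E (S (E y))) (S y),
    forall f, kappa S f v = kappa S (unflat f) (idm (S (E y))).
  have ls : scalar (fun f : hom y (ae_inv E (S (E y))) =>
      kappa S (unflat f) (idm (S (E y)))).
    by move=> a f f'; rewrite -kappa_linear /unflat linearP compmD compmZ.
  pose l : {scalar hom y (ae_inv E (S (E y)))} :=
    HB.pack (fun f => kappa S (unflat f) (idm (S (E y))))
      (GRing.isLinear.Build _ _ _ _ _ ls).
  by have [v hv] := kappa_surjr S l; exists v.
pose z (y : D) : hom (S (E y)) (E (S y)) := unsharp (projT1 (cid (ex_z y))).
have zP (x y : D) (e : hom (E y) x) (u : hom x (S (E y))) :
    kappa S e u = kappa S (flat e) (sharp (z y \c u)).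
  rewrite sharp_comp /z unsharpK -kappa_compl -flat_comp.
  by case: (cid _) => v /= ->; rewrite flatK kappa1.
have z_inj (x y : D) (u u' : hom x (S (E y))) : z y \c u = z y \c u' -> u = u'.
  by move=> zu; apply: kappa_injr => e; rewrite !zP zu.
have z_inv (y : D) : exists w : hom (E (S y)) (S (E y)),
    w \c z y = idm _ /\ z y \c w = idm _.
  have [w hw] := ex_rep _ _ (idm (E (S y))).
  have zw : z y \c w = idm _.
    apply: (can_inj (@sharpK E _ _)); apply: kappa_injr => f.
    by rewrite -[f]unflatK -hw -zP.
  by exists w; split => //; apply: z_inj; rewrite compA zw comp1m compm1.
have z_nat (y y' : D) (f : hom y y') :
    z y' \c fmap S (fmap E f) = fmap E (fmap S f) \c z y.
  have [w [_ zw]] := z_inv y.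
  apply: (can_inj (@sharpK E _ _)); apply: kappa_injr => g.
  rewrite -[g]unflatK -zP sharp_fmap -kappa_compr -flat_fmap.
  rewrite -[z y]compm1 -zP.
  by have := kappa_compr (unflat g) (fmap E f) (idm (S (E y))); rewrite compm1.
exists (@NatIso k D (fcomp S E) (fcomp E S) z
  (fun y => projT1 (cid (z_inv y))) z_nat
  (fun y => proj1 (projT2 (cid (z_inv y))))
  (fun y => proj2 (projT2 (cid (z_inv y))))).
exact: zP.
Qed.

Lemma is_zeta_uniq S E z z' :
  @is_zeta S E z -> @is_zeta S E z' -> forall y, z y = z' y.
Proof.
move=> hz hz' y; apply: (can_inj (@sharpK E _ _)); apply: kappa_injr => f.
by rewrite -[f]unflatK -[z y]compm1 -[z' y]compm1 -hz -hz'.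
Qed.

Definition zeta S E : nat_iso (fcomp S E) (fcomp E S) := projT1 (cid (zeta_ex S E)).

Lemma zetaP S E : is_zeta (zeta S E).
Proof. exact: projT2 (cid (zeta_ex S E)). Qed.

Definition zeta_dagger S E :
  nat_iso (fcomp (ae_inv S) E) (fcomp E (ae_inv S)).
Proof.
refine (@NatIso k D (fcomp (ae_inv S) E) (fcomp E (ae_inv S))
  (fun x => ae_counit S (E (ae_inv S x)) \c
            fmap (ae_inv S) (niso_inv (zeta S E) (ae_inv S x)) \c
            fmap (ae_inv S) (fmap E (ae_unit S x)))
  (fun x => fmap (ae_inv S) (fmap E (niso_inv (ae_unit S) x)) \c
            fmap (ae_inv S) (zeta S E (ae_inv S x)) \c
            niso_inv (ae_counit S) (E (ae_inv S x))) _ _ _).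
- move=> x y f /=.
  have /= eu := niso_nat (ae_unit S) f.
  have /= ez := niso_inv_nat (zeta S E) (fmap (ae_inv S) f).
  have /= ec := niso_nat (ae_counit S) (fmap E (fmap (ae_inv S) f)).
  rewrite -[LHS]compA -fmapM -fmapM eu -[LHS]compA -fmapM (fmapM E) compA ez.
  by rewrite -compA (fmapM (ae_inv S)) compA ec fmapM !compA.
- move=> x /=; have /= ez := nisoVK (zeta S E) (ae_inv S x).
  have /= eu := nisoK (ae_unit S) x.
  have /= ec := nisoK (ae_counit S) (E (ae_inv S x)).
  rewrite -!compA (compA (niso_inv (ae_counit S) _)) ec comp1m.
  rewrite (compA (fmap (ae_inv S) (zeta S E (ae_inv S x)))) -fmapM ez fmap1 comp1m.
  by rewrite -!fmapM eu !fmap1.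
- move=> x /=; have /= ez := nisoK (zeta S E) (ae_inv S x).
  have /= eu := nisoVK (ae_unit S) x.
  have /= ec := nisoVK (ae_counit S) (E (ae_inv S x)).
  rewrite -!compA (compA (fmap (ae_inv S) (fmap E _))) -!fmapM eu !fmap1 comp1m.
  by rewrite (compA (fmap (ae_inv S) _)) -fmapM ez fmap1 comp1m ec.
Defined.

End SerreStructures.

(* Characters Z -> k^*. *)
Record character (k : fieldType) := Character {
  char_fun :> int -> k;
  char_neq0 : forall n, char_fun n != 0;
  charD : forall m n, char_fun (m + n) = char_fun m * char_fun n }.

Section SyntheticCalabiYau.
Context {k : fieldType} {D : kcategory k}.
Context (chi : character k).
Implicit Types (S : serre_structure D) (E : autoequivalence D).
Implicit Types (F : automorphism D).

Definition chi_zeta S E : nat_iso (fcomp S E) (fcomp E S) :=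
  niso_scale (char_neq0 chi 1) (zeta S E).

Definition chi_serre_functor S E (s : nat_iso (fcomp S E) (fcomp E S)) : Prop :=
  forall x : D, s x = chi 1 *: zeta S E x.

(* [(E, id_{E^2})] and [(E, chi(1) id_{E^2})] as [E]-equivariant functors. *)
Definition eqv_self E : equivariant E := Equivariant (niso_id (fcomp E E)).

Definition eqv_chi E : equivariant E :=
  Equivariant (niso_scale (char_neq0 chi 1) (niso_id (fcomp E E))).

Definition synthetic_CY F S (N m : nat) : Prop :=
  Equivariant (chi_zeta S F) ^^ m ~= eqv_chi F ^^ N.

(* [T = S^- F], with quasi-inverse [F^- S]. *)
Definition serreT S F : autoequivalence D := ae_comp (ae_sym S) F.

(* [zeta_F^dagger F : T F -> F T]. *)
Definition zeta_dagger_F S F :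
  nat_iso (fcomp (serreT S F) F) (fcomp F (serreT S F)) :=
  let z := zeta_dagger S F in
  @NatIso k D (fcomp (serreT S F) F) (fcomp F (serreT S F))
    (fun x => z (F x)) (fun x => niso_inv z (F x))
    (fun x y f => niso_nat z (fmap F f))
    (fun x => nisoK z (F x)) (fun x => nisoVK z (F x)).

End SyntheticCalabiYau.

Arguments chi_serre_functor {k D} chi S E s.

(* Main.v *)
From Stdlib Require Import Setoid Morphisms.
From mathcomp Require Import all_boot all_order all_algebra.
Require Import Defs.

(** Write [s = (S, chi(1) zeta_F)], [t = (T, zeta_F^dagger F)] and
    [f = (F, chi(1) id)] for the three [F]-equivariant functors in play, and
    calculate with isomorphism classes of [F]-equivariant endofunctors, which
    form a monoid.  Since [T = S^- F], the isomorphism [S T ~= F] given by the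
    inverse of the unit is equivariant: [f = s t] ([eqv_scalar_split]).  As
    [f] is central ([eqv_scalar_central]) and equivalences can be cancelled on
    the left ([eqv_comp_cancel]), [s] and [t] commute
    ([eqv_serre_dagger_comm]).  Condition (a) reads [s^m = f^N] and condition
    (c) reads [t^m = f^r]; with [m = N + r] and [f = s t], cancelling [s^N] in
    the first and [t^r] in the second turns both into [s^r = t^N]
    ([eqv_pow_split]).

    Condition (b) is the same equation, read for [T]-equivariant functors.
    Put [tr u = kappa id u].  A fully faithful [Phi] has at most one
    isomorphism [sigma : Phi S -> S Phi] with [tr (sigma (Phi w)) = tr w], and
    every natural isomorphism between fully faithful functors respects these
    [sigma] ([tr_preserving_nat]); for an autoequivalence [E] it is the
    inverse of [zeta_E], and for [S] itself it is the identity.  Because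
    [F ~= S T], an [F]-structure on such a [Phi] is a [T]-structure combined
    with [sigma]; [matched] records this.  Isomorphisms of [F]-equivariant
    functors are therefore the same as isomorphisms of the matching
    [T]-equivariant ones ([matched_isom]), matching is stable under powers,
    [s] matches [(S, chi(1) zeta_T)] and [t] matches [(T, id)]. *)

Import GRing.Theory.
Local Open Scope ring_scope.
Local Open Scope kcat_scope.

Set Implicit Arguments.
Unset Strict Implicit.
Unset Printing Implicit Defensive.

(** * Fully faithful functors and adjoint equivalences *)

Section FullyFaithful.
Context {k : fieldType} {D : kcategory k}.
Implicit Types (Phi Psi : endofunctor D) (E : autoequivalence D).

(** The inverse maps are chosen for all hom spaces at once, so that natural
    isomorphisms can be lifted along [Phi] without a choice principle. *)
Definition fully_faithful Phi : Prop :=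
  exists g : forall x y : D, hom (Phi x) (Phi y) -> hom x y,
    forall x y, cancel (fmap Phi) (g x y) /\ cancel (g x y) (fmap Phi).

Lemma fully_faithful_id : fully_faithful (fid D).
Proof. by exists (fun x y f => f). Qed.

Lemma fully_faithful_comp Phi Psi :
  fully_faithful Phi -> fully_faithful Psi -> fully_faithful (fcomp Phi Psi).
Proof.
move=> [g gP] [h hP]; exists (fun x y f => h x y (g _ _ f)) => x y.
have [gK Kg] := gP (Psi x) (Psi y); have [hK Kh] := hP x y.
by split=> f /=; rewrite ?gK ?hK ?Kh ?Kg.
Qed.

Lemma fully_faithful_inj Phi (x y : D) :
  fully_faithful Phi -> injective (@fmap k D Phi x y).
Proof. by move=> [g gP]; have [/can_inj] := gP x y. Qed.

Lemma niso_injl (x y : D) Phi Psi (a : nat_iso Phi Psi) (f g : hom x (Phi y)) :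
  a y \c f = a y \c g -> f = g.
Proof.
move=> /(congr1 (comp (niso_inv a y))).
by rewrite !compA nisoK !comp1m.
Qed.

Lemma niso_injr (x y : D) Phi Psi (a : nat_iso Phi Psi) (f g : hom (Psi x) y) :
  f \c a x = g \c a x -> f = g.
Proof.
move=> /(congr1 (fun h => h \c niso_inv a x)).
by rewrite -!compA nisoVK !compm1.
Qed.

Lemma ae_unit_counit E (x : D) :
  fmap E (niso_inv (ae_counit E) x) = ae_unit E (E x).
Proof.
have /= e := nisoK (ae_counit E) x.
by rewrite -[RHS]comp1m -[idm _](fmap1 E) -e fmapM -compA ae_triangle compm1.
Qed.

Lemma ae_counit_unit E (x : D) :
  fmap E (ae_counit E x) = niso_inv (ae_unit E) (E x).
Proof.
have /= e := nisoVK (ae_unit E) (E x).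
by rewrite -[LHS]compm1 -e compA ae_triangle comp1m.
Qed.

Lemma fully_faithful_ae E : fully_faithful E.
Proof.
exists (fun x y f => sharp f \c niso_inv (ae_counit E) x) => x y; split=> f.
  have /= e := niso_nat (ae_counit E) f.
  have /= e' := nisoVK (ae_counit E) x.
  by rewrite /sharp e -compA e' compm1.
rewrite fmapM ae_unit_counit; exact: (@sharpK k D E).
Qed.

End FullyFaithful.

(** * The monoid of isomorphism classes of equivariant functors *)

Section IsoClasses.
Context {k : fieldType} {D : kcategory k} {E : endofunctor D}.
Implicit Types (P Q R : equivariant E).

Lemma eqv_isom_refl P : P ~= P.
Proof. by exists (niso_id P) => x /=; rewrite fmap1 comp1m compm1. Qed.

Lemma eqv_isom_sym P Q : P ~= Q -> Q ~= P.
Proof.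
move=> [a ae]; exists (niso_sym a) => x /=.
have /= e := nisoVK a (E x); have /= e' := nisoK a x.
rewrite -[RHS]compm1 -e -!compA (compA _ (a (E x))) ae.
by rewrite !compA -fmapM e' fmap1 comp1m.
Qed.

Definition niso_trans (F G H : endofunctor D) (a : nat_iso F G) (b : nat_iso G H) :
  nat_iso F H.
Proof.
refine (@NatIso k D F H (fun x => b x \c a x)
  (fun x => niso_inv a x \c niso_inv b x) _ _ _) => [x y f|x|x].
- by rewrite -compA niso_nat compA niso_nat -compA.
- by rewrite compA -(compA _ _ (b x)) nisoK compm1 nisoK.
- by rewrite compA -(compA _ _ (niso_inv a x)) nisoVK compm1 nisoVK.
Defined.

Lemma eqv_isom_trans Q P R : P ~= Q -> Q ~= R -> P ~= R.
Proof.
move=> [a ae] [b be]; exists (niso_trans a b) => x /=.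
by rewrite compA be -compA ae compA fmapM.
Qed.

#[global] Instance eqv_isom_equiv : Equivalence (@eqv_isom k D E).
Proof.
split; [exact: eqv_isom_refl|exact: eqv_isom_sym|].
by move=> P Q R; exact: eqv_isom_trans.
Qed.

Definition niso_hcomp (F F' G G' : endofunctor D) (a : nat_iso F F')
  (b : nat_iso G G') : nat_iso (fcomp F G) (fcomp F' G').
Proof.
refine (@NatIso k D (fcomp F G) (fcomp F' G')
  (fun x => a (G' x) \c fmap F (b x))
  (fun x => fmap F (niso_inv b x) \c niso_inv a (G' x)) _ _ _) => [x y f|x|x] /=.
- by rewrite -compA -fmapM (niso_nat b f) fmapM compA niso_nat -compA.
- by rewrite -compA (compA _ (a _)) nisoK comp1m -fmapM nisoK fmap1.
- by rewrite -compA (compA (fmap F (b x))) -fmapM nisoVK fmap1 comp1m nisoVK.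
Defined.

#[global] Instance eqv_comp_proper :
  Proper (@eqv_isom k D E ==> @eqv_isom k D E ==> @eqv_isom k D E) eqv_comp.
Proof.
move=> P P' [a ae] Q Q' [b be]; exists (niso_hcomp a b) => x /=.
have /= e := niso_nat (eqv_iso P) (b x).
have /= e' := niso_nat a (eqv_iso Q' x).
rewrite -compA (compA _ (a _)) -e' !compA ae -!compA -fmapM be fmapM.
by rewrite fmapM -!compA; congr (_ \c _); rewrite !compA e.
Qed.

(** The two bracketings agree on objects and maps but carry different proofs
    of functoriality, so the identities have to be packed as an isomorphism
    between distinct functors; the unit laws below are alike. *)
Lemma eqv_comp_assoc P Q R :
  eqv_comp (eqv_comp P Q) R ~= eqv_comp P (eqv_comp Q R).
Proof.
unshelve eexists.
  by apply: (@NatIso k D (eqv_comp (eqv_comp P Q) R) (eqv_comp P (eqv_comp Q R))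
    (fun x => idm _) (fun x => idm _)) => [x y f|x|x] /=; rewrite comp1m ?compm1.
by move=> x /=; rewrite !fmap1 compm1 comp1m fmapM compA.
Qed.

Lemma eqv_comp1l P : eqv_comp eqv_id P ~= P.
Proof.
unshelve eexists.
  by apply: (@NatIso k D (eqv_comp eqv_id P) P (fun x => idm _) (fun x => idm _))
    => [x y f|x|x] /=; rewrite comp1m ?compm1.
by move=> x /=; rewrite !fmap1 !compm1 !comp1m.
Qed.

Lemma eqv_comp1r P : eqv_comp P eqv_id ~= P.
Proof.
unshelve eexists.
  by apply: (@NatIso k D (eqv_comp P eqv_id) P (fun x => idm _) (fun x => idm _))
    => [x y f|x|x] /=; rewrite comp1m ?compm1.
by move=> x /=; rewrite !fmap1 !compm1 !comp1m.
Qed.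

(** An isomorphism [P Q -> P R] lifts along [P] componentwise, and its
    equivariance lifts once the structure map of [P] has been cancelled. *)
Lemma eqv_comp_cancel P Q R : fully_faithful P ->
  eqv_comp P Q ~= eqv_comp P R -> Q ~= R.
Proof.
move=> ffP [a ae]; have [g gP] := ffP.
have gK x y : cancel (g x y) (fmap P) by have [] := gP x y.
have inj x y : injective (@fmap k D P x y) by exact: fully_faithful_inj.
unshelve eexists.
  apply: (@NatIso k D Q R (fun x => g _ _ (a x)) (fun x => g _ _ (niso_inv a x))).
  - by move=> x y f; apply: inj; rewrite !fmapM !gK; exact: (niso_nat a f).
  - by move=> x; apply: inj; rewrite fmapM !gK fmap1; exact: (nisoK a x).
  - by move=> x; apply: inj; rewrite fmapM !gK fmap1; exact: (nisoVK a x).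
move=> x /=; apply: inj; rewrite !fmapM gK.
have /= e := niso_nat (eqv_iso P) (g _ _ (a x)); rewrite gK in e.
have /= v y := nisoK (eqv_iso P) (R y).
rewrite -[LHS]comp1m -[RHS]comp1m -v -!compA; congr (_ \c _).
by have /= := ae x; rewrite compA -e -!compA.
Qed.

Lemma eqv_pow_isom P Q n : P ~= Q -> P ^^ n ~= Q ^^ n.
Proof.
by move=> PQ; elim: n => [|n /= IH]; [reflexivity | rewrite IH PQ; reflexivity].
Qed.

Lemma eqv_powD P i j : P ^^ (i + j) ~= eqv_comp (P ^^ i) (P ^^ j).
Proof.
elim: i => [|i /= IH]; first by rewrite eqv_comp1l; reflexivity.
by rewrite eqv_comp_assoc IH; reflexivity.
Qed.

Lemma eqv_pow_comm P Q n :
  eqv_comp P Q ~= eqv_comp Q P -> eqv_comp (P ^^ n) Q ~= eqv_comp Q (P ^^ n).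
Proof.
move=> PQ; elim: n => [|n /= IH].
  by rewrite eqv_comp1l eqv_comp1r; reflexivity.
by rewrite eqv_comp_assoc IH -!eqv_comp_assoc PQ; reflexivity.
Qed.

Lemma eqv_powM P Q n : eqv_comp P Q ~= eqv_comp Q P ->
  (eqv_comp P Q) ^^ n ~= eqv_comp (P ^^ n) (Q ^^ n).
Proof.
move=> PQ; elim: n => [|n /= IH]; first by rewrite eqv_comp1l; reflexivity.
rewrite IH !eqv_comp_assoc -(eqv_comp_assoc Q) -(eqv_comp_assoc (P ^^ n)).
by rewrite (eqv_pow_comm _ PQ); reflexivity.
Qed.

Lemma eqv_pow_cancel P Q R n : fully_faithful P ->
  eqv_comp (P ^^ n) Q ~= eqv_comp (P ^^ n) R -> Q ~= R.
Proof.
move=> ffP; elim: n => [|n IH /=]; first by rewrite !eqv_comp1l.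
by rewrite !eqv_comp_assoc => /(eqv_comp_cancel ffP)/IH.
Qed.

(** By commutation [R^i = P^i Q^i], and [P^i] cancels against
    [P^(i + j) = P^i P^j].  The theorem uses this twice, with the roles of [P]
    and [Q] exchanged. *)
Lemma eqv_pow_split (P Q R : equivariant E) i j : fully_faithful P ->
    R ~= eqv_comp P Q -> eqv_comp P Q ~= eqv_comp Q P ->
  (P ^^ (i + j) ~= R ^^ i <-> P ^^ j ~= Q ^^ i).
Proof.
move=> ffP RPQ PQ.
rewrite (eqv_pow_isom i RPQ) (eqv_powM i PQ) eqv_powD.
by split=> [/(eqv_pow_cancel ffP)//|->]; reflexivity.
Qed.

End IsoClasses.

(** * The Serre trace and the functors that preserve it *)

Section Trace.
Context {k : fieldType} {D : kcategory k} (S : serre_structure D).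
Implicit Types (P Q : equivariant S) (E : autoequivalence D).

(** The trace determines the Serre structure ([kappa_tr]), is cyclic up to
    [S] ([trC]) and nondegenerate ([tr_inj]). *)
Definition tr (x : D) (u : hom x (S x)) : k := kappa S (idm x) u.

Lemma kappa_tr (x y : D) (g : hom x y) (u : hom y (S x)) :
  kappa S g u = tr (u \c g).
Proof. by rewrite /tr -kappa_compl compm1. Qed.

Lemma trC (x y : D) (g : hom x y) (u : hom y (S x)) :
  tr (u \c g) = tr (fmap S g \c u).
Proof. by rewrite -kappa_tr -{1}[g]comp1m kappa_compr. Qed.

Lemma tr_inj (x y : D) (u u' : hom y (S x)) :
  (forall f : hom x y, tr (u \c f) = tr (u' \c f)) -> u = u'.
Proof. by move=> e; apply: kappa_injr => f; rewrite !kappa_tr. Qed.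

(** The structure map [sigma : P S -> S P] lets [P] act on the maps
    [w : y -> S y] that have a trace, and it is the inverse of the canonical
    [zeta_P] exactly when this action leaves the trace unchanged.  Unlike the
    characterisation of [zeta] by adjuncts, this makes sense for endofunctors
    without a chosen quasi-inverse, such as powers, and is evidently stable
    under composition. *)
Definition tr_preserving P : Prop :=
  forall (y : D) (w : hom y (S y)), tr (eqv_iso P y \c fmap P w) = tr w.

Lemma tr_preserving_id : tr_preserving eqv_id.
Proof. by move=> y w; rewrite comp1m. Qed.

Lemma tr_preserving_comp P Q :
  tr_preserving P -> tr_preserving Q -> tr_preserving (eqv_comp P Q).
Proof. by move=> trP trQ y w /=; rewrite -compA -fmapM trP trQ. Qed.

(** Cyclicity applied to [u = id] gives [tr (S w) = tr w]; in other words
    [zeta_S] is the identity. *)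
Lemma tr_preserving_serre : tr_preserving (eqv_self S).
Proof. by move=> y w /=; rewrite comp1m -[_ w]compm1 -trC comp1m. Qed.

Lemma tr_preserving_zeta E :
  tr_preserving (Equivariant (niso_sym (zeta S E))).
Proof.
move=> y w; rewrite -kappa_tr (@zetaP k D S E).
have /= -> := nisoVK (zeta S E) y.
have -> : flat (fmap E w) = flat (idm (E (S y))) \c w.
  by rewrite -flat_fmap comp1m.
rewrite kappa_tr compA; have /= e := nisoVK (ae_counit E) (S y).
by rewrite /sharp /flat !fmap1 comp1m compm1 e comp1m.
Qed.

(** By nondegeneracy both sides may be composed with [f : Q y -> P S y] and
    traced.  Fullness of [P] gives [f a = P w]; by cyclicity the right side
    then has trace [tr w], and so does the left, since naturality of [a] turns
    [a f] into [Q w].  The case where [a] is an identity is the uniqueness of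
    the canonical structure map. *)
Lemma tr_preserving_nat P Q (a : nat_iso P Q) :
    fully_faithful P -> tr_preserving P -> tr_preserving Q ->
  forall y, eqv_iso Q y \c a (S y) = fmap S (a y) \c eqv_iso P y.
Proof.
move=> [g gP] trP trQ y; apply: tr_inj => f; have [_ gK] := gP y (S y).
have /= e := nisoVK a y.
have fE : f = fmap P (g _ _ (f \c a y)) \c niso_inv a y.
  by rewrite gK -compA e compm1.
rewrite -(compA (fmap S _)) -trC -compA -(compA (eqv_iso P y)).
rewrite -(gK (f \c a y)) trP {1}fE (compA (a (S y))) niso_nat.
by rewrite -compA e compm1 trQ.
Qed.

End Trace.

(** * The factorisation of F as S T *)

Section SerreTwist.
Context {k : fieldType} {D : kcategory k}.
Context (F : automorphism D) (S : serre_structure D).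
Let T := serreT S F.

Definition untwist (x : D) : hom (S (T x)) (F x) := niso_inv (ae_unit S) (F x).

Definition untwist_iso : nat_iso (fcomp S T) F :=
  @NatIso k D (fcomp S T) F untwist (fun x => ae_unit S (F x))
    (fun x y f => niso_inv_nat (ae_unit S) (fmap F f))
    (fun x => nisoVK (ae_unit S) (F x)) (fun x => nisoK (ae_unit S) (F x)).

(** This is [tr_preserving_nat] for the isomorphism [S T ~= F]: the canonical
    structure of [S T] is composed of the identity on [S S] and [zeta_T]. *)
Lemma zeta_untwist (x : D) :
  zeta S F x \c fmap S (untwist x) = untwist (S x) \c fmap S (zeta S T x).
Proof.
have /= := @tr_preserving_nat k D S
  (eqv_comp (eqv_self S) (Equivariant (niso_sym (zeta S T))))
  (Equivariant (niso_sym (zeta S F))) untwist_iso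
  (fully_faithful_comp (fully_faithful_ae S) (fully_faithful_ae T))
  (tr_preserving_comp (@tr_preserving_serre _ _ S) (@tr_preserving_zeta _ _ S T))
  (@tr_preserving_zeta _ _ S F) x.
rewrite comp1m => e.
have /= eT := nisoK (zeta S T) x; have /= eF := nisoVK (zeta S F) x.
have /(congr1 (fun h => zeta S F x \c h \c fmap S (zeta S T x))) := e.
rewrite !compA eF comp1m => ->.
by rewrite -!compA -fmapM eT fmap1 compm1.
Qed.

(** Applying [S] removes the counit from the definition of [zeta^dagger],
    because [S epsilon] is inverse to [eta S]. *)
Lemma zeta_dagger_unit (y : D) :
  fmap S (zeta_dagger S F y) =
    niso_inv (zeta S F) (ae_inv S y) \c fmap F (ae_unit S y) \c
    niso_inv (ae_unit S) (F y).
Proof.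
have /= e := niso_inv_nat (ae_unit S)
  (niso_inv (zeta S F) (ae_inv S y) \c fmap F (ae_unit S y)).
by rewrite -e /= !fmapM ae_counit_unit compA.
Qed.

Variables (c : k) (c0 : c != 0).

Definition eqv_serre (E : autoequivalence D) : equivariant E :=
  Equivariant (niso_scale c0 (zeta S E)).

Definition eqv_dagger : equivariant F := Equivariant (zeta_dagger_F S F).

Definition eqv_scalar (E : endofunctor D) : equivariant E :=
  Equivariant (niso_scale c0 (niso_id (fcomp E E))).

(** The structure map of [P] is itself the commutation isomorphism. *)
Lemma eqv_scalar_central (E : endofunctor D) (P : equivariant E) :
  eqv_comp P (eqv_scalar E) ~= eqv_comp (eqv_scalar E) P.
Proof.
exists (eqv_iso P) => x /=.
by rewrite linearZ fmap1 /= !compZm comp1m !compmZ compm1.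
Qed.

Lemma eqv_scalar_split :
  eqv_scalar F ~= eqv_comp (eqv_serre F) eqv_dagger.
Proof.
apply: eqv_isom_sym; exists untwist_iso => x /=.
rewrite !compZm compmZ comp1m; congr (_ *: _).
rewrite [X in _ \c (_ \c X)]zeta_dagger_unit /untwist.
have /= eF := nisoVK (zeta S F) (ae_inv S (F x)).
have /= eu := nisoK (ae_unit S) (F x).
by rewrite !compA -(compA _ (zeta S F _)) eF compm1 -fmapM eu fmap1 comp1m.
Qed.

(** [s (s t) = s f = f s = (s t) s = s (t s)], and [s] can be cancelled. *)
Lemma eqv_serre_dagger_comm :
  eqv_comp (eqv_serre F) eqv_dagger ~= eqv_comp eqv_dagger (eqv_serre F).
Proof.
have fE := eqv_scalar_split.
apply: (eqv_comp_cancel (fully_faithful_ae S : fully_faithful (eqv_serre F))).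
apply: eqv_isom_trans (eqv_comp_assoc _ _ _).
by rewrite -fE; exact: eqv_scalar_central.
Qed.

(** Up to the isomorphism [S T ~= F], [zeta_F^dagger F] is the inverse of
    [zeta_T T]; this is what makes [t] match [(T, id)]. *)
Lemma zeta_dagger_untwist (x : D) :
  zeta_dagger S F (F x) \c fmap T (untwist x) \c zeta S T (T x) = untwist (T x).
Proof.
apply: (fully_faithful_inj (fully_faithful_ae S)).
rewrite 2![fmap S (_ \c _)]fmapM zeta_dagger_unit.
have /= e1 := niso_inv_nat (ae_unit S) (fmap F (untwist x)).
have /= e2 := nisoVK (ae_unit S) (F x).
rewrite -(compA _ (niso_inv (ae_unit S) _)) e1.
rewrite !compA -(compA _ (fmap F (ae_unit S _))) -fmapM e2 fmap1 compm1.
apply: (@niso_injl _ _ _ (T x) _ _ (zeta S F)); rewrite !compA.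
rewrite [X in X \c _ \c _ = _](nisoVK (zeta S F) (T x)).
by rewrite comp1m -[LHS]zeta_untwist.
Qed.

(** * Comparing F-equivariant and T-equivariant functors *)

(** Under [F ~= S T], a structure [phi] for [F] should be a structure [psi] for
    [T] composed with the canonical structure [sigma] for [S].  A relation,
    rather than a map from one kind of structure to the other, avoids casts for
    powers: there the underlying functors for [F] and for [T] are equal only
    propositionally. *)
Inductive matched : equivariant F -> equivariant T -> Prop :=
  Matched (Phi : endofunctor D) (phi : nat_iso (fcomp Phi F) (fcomp F Phi))
    (psi : nat_iso (fcomp Phi T) (fcomp T Phi))
    (sigma : nat_iso (fcomp Phi S) (fcomp S Phi)) of
    fully_faithful Phi & tr_preserving (Equivariant sigma) &
    (forall x : D, phi x \c fmap Phi (untwist x) =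
       untwist (Phi x) \c fmap S (psi x) \c sigma (T x)) :
  matched (Equivariant phi) (Equivariant psi).

Lemma matched_id : matched eqv_id eqv_id.
Proof.
apply: (@Matched _ _ _ eqv_id_iso) => [||x] /=.
- exact: fully_faithful_id.
- exact: tr_preserving_id.
- by rewrite fmap1 !compm1 comp1m.
Qed.

Lemma matched_comp P P' Q Q' :
  matched P Q -> matched P' Q' -> matched (eqv_comp P P') (eqv_comp Q Q').
Proof.
case=> Phi phi psi sg ff tp e [Phi' phi' psi' sg' ff' tp' e'].
apply: (@Matched _ _ _ (eqv_comp_iso (Equivariant sg) (Equivariant sg'))) => [||x] /=.
- exact: fully_faithful_comp.
- exact: (tr_preserving_comp tp tp').
have /= n := niso_nat sg (psi' x).
rewrite -compA -fmapM e' !fmapM compA compA e.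
rewrite -!compA; congr (_ \c (_ \c _)).
by rewrite !compA n.
Qed.

Lemma matched_pow P Q n : matched P Q -> matched (P ^^ n) (Q ^^ n).
Proof.
move=> PQ; elim: n => [|n IH]; first exact: matched_id.
exact: matched_comp.
Qed.

(** The canonical structures [sigma] are respected by every isomorphism, so
    under [F ~= S T] compatibility with [phi] amounts to the [S]-image of
    compatibility with [psi], and [S] is faithful. *)
Lemma matched_isom P Q P' Q' :
  matched P Q -> matched P' Q' -> (P ~= P' <-> Q ~= Q').
Proof.
case=> Phi phi psi sg ff tp e [Phi' phi' psi' sg' ff' tp' e'].
(* The two sides of the [F]-square, composed with [Phi (S T) ~= Phi F], are
   the [S]-images of the two sides of the [T]-square between isomorphisms. *)
have key (a : nat_iso Phi Phi') x :
    phi' x \c a (F x) \c fmap Phi (untwist x) =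
      untwist (Phi' x) \c fmap S (psi' x \c a (T x)) \c sg (T x) /\
    fmap F (a x) \c phi x \c fmap Phi (untwist x) =
      untwist (Phi' x) \c fmap S (fmap T (a x) \c psi x) \c sg (T x).
  have n : sg' (T x) \c a (S (T x)) = fmap S (a (T x)) \c sg (T x).
    exact: (@tr_preserving_nat _ _ S (Equivariant sg) (Equivariant sg')).
  have /= u := niso_nat untwist_iso (a x).
  split; last by rewrite -compA e fmapM !compA u.
  rewrite -compA niso_nat compA e' /=; rewrite /= in n.
  by rewrite -compA n fmapM !compA.
split=> -[a /= ae]; exists a => x /=; have [kl kr] := key a x.
  apply: (fully_faithful_inj (fully_faithful_ae S)).
  apply: (@niso_injl _ _ _ (Phi' x) _ _ untwist_iso).
  apply: (@niso_injr _ _ (T x) _ _ _ sg).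
  by rewrite -[LHS]kl -[RHS]kr ae.
have e2 : fmap Phi (untwist x) \c fmap Phi (ae_unit S (F x)) = idm (Phi (F x)).
  by have /= u := nisoK (ae_unit S) (F x); rewrite -fmapM u fmap1.
rewrite -[LHS]compm1 -[RHS]compm1 -e2 !compA; congr (_ \c _).
by rewrite kl kr ae.
Qed.

Lemma matched_serre (s' : nat_iso (fcomp S T) (fcomp T S)) :
    (forall x, s' x = c *: zeta S T x) ->
  matched (eqv_serre F) (Equivariant s').
Proof.
move=> s'E; apply: (@Matched S _ _ (niso_id (fcomp S S))) => [||x] /=.
- exact: fully_faithful_ae.
- exact: tr_preserving_serre.
- by rewrite s'E linearZ /= compZm zeta_untwist compmZ compm1.
Qed.

Lemma matched_dagger : matched eqv_dagger (eqv_self T).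
Proof.
apply: (@Matched T _ _ (niso_sym (zeta S T))) => [||x].
- exact: (fully_faithful_ae T).
- exact: tr_preserving_zeta.
rewrite -zeta_dagger_untwist /=.
apply: (@niso_injr _ _ (T x) _ _ _ (zeta S T)).
have /= e := nisoK (zeta S T) (T x).
by rewrite -[RHS]compA e fmap1 !compm1.
Qed.

End SerreTwist.

Theorem theorem5p13 (k : fieldType) (D : kcategory k) (F : automorphism D)
    (S : serre_structure D) (chi : character k) (N m r : nat)
    (leNm : (N <= m)%N) (rE : r = (m - N)%N) :
  let T := serreT S F in
  [<-> synthetic_CY chi F S N m;
       exists s' : nat_iso (fcomp S T) (fcomp T S),
         chi_serre_functor chi S T s' /\
         Equivariant s' ^^ r ~= eqv_self T ^^ N;
       (exists s : nat_iso (fcomp S F) (fcomp F S), chi_serre_functor chi S F s) /\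
         Equivariant (zeta_dagger_F S F) ^^ m ~= eqv_chi chi F ^^ r ].
Proof.
move=> T; have mE : m = (N + r)%N by rewrite rE subnKC.
pose s := eqv_serre S (char_neq0 chi 1) F; pose t := eqv_dagger F S.
have st := eqv_serre_dagger_comm F S (char_neq0 chi 1).
have fE := eqv_scalar_split F S (char_neq0 chi 1).
(* For (c) the roles of [s] and [t] are exchanged, so [f = t s] is needed. *)
have fE' := eqv_isom_trans fE st.
have ac : synthetic_CY chi F S N m <-> s ^^ r ~= t ^^ N.
  rewrite /synthetic_CY mE.
  exact: (@eqv_pow_split _ _ _ s t (eqv_scalar _ F) N r (fully_faithful_ae S) fE st).
have cc : t ^^ m ~= eqv_chi chi F ^^ r <-> t ^^ N ~= s ^^ r.
  rewrite mE addnC.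
  exact: (@eqv_pow_split _ _ _ t s (eqv_scalar _ F) r N (fully_faithful_ae T)
    fE' (eqv_isom_sym st)).
have bc (s' : nat_iso (fcomp S T) (fcomp T S)) : chi_serre_functor chi S T s' ->
    (s ^^ r ~= t ^^ N <-> Equivariant s' ^^ r ~= eqv_self T ^^ N).
  move=> s'E; apply: matched_isom; apply: matched_pow.
    exact: matched_serre.
  exact: matched_dagger.
tfae.
- move=> /ac h; exists (chi_zeta chi S T).
  have e : chi_serre_functor chi S T (chi_zeta chi S T) by [].
  by split=> //; apply/(bc _ e).
- move=> [s' [/bc e /e h]]; split; first by exists (chi_zeta chi S F).
  exact/cc/eqv_isom_sym.
- by move=> [_ /cc h]; exact/ac/eqv_isom_sym.
Qed.
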